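(* If $0<V_0\le V$ are finite-dimensional vector spaces over a field $\mathbb{F}\neq\mathbb{F}_2$, then the coinvariants $\operatorname{St}(V,V_0)_{A^T(V,V_0)}$ vanish.
   Context: $\mathcal{P}(V,V_0)$ is the poset, ordered by inclusion, of proper subspaces $W<V$ with $W+V_0=V$; $\operatorname{St}(V,V_0)=\tilde H_{\dim V_0-1}(\mathcal{P}(V,V_0);\mathbb{Z})$. The group $A^T(V,V_0)$ is the subgroup of $g\in\operatorname{GL}(V)$ with $gV_0=V_0$ and inducing the identity on $V/V_0$ (equivalently $g(v)-v\in V_0$ for all $v$); it acts on $\mathcal{P}(V,V_0)$ and hence on $\operatorname{St}(V,V_0)$. *)

(* Defs.v *)
From HB Require Import structures.
From mathcomp Require Import all_boot all_order all_algebra.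
Set Implicit Arguments. Unset Strict Implicit. Unset Printing Implicit Defensive.
Import GRing.Theory.
Local Open Scope ring_scope.

(* Setting: V is the (finite-dimensional) vectType vT over the field F, viewed
   as the full space fullv; V0 : {vspace vT}.                                *)
Section Steinberg.
Variables (F : fieldType) (vT : vectType F) (V0 : {vspace vT}).

Definition inP (W : {vspace vT}) : bool :=
  (W != fullv) && ((W + V0)%VS == fullv).

Definition ltvs (U W : {vspace vT}) : bool := (U <= W)%VS && (U != W).

(* n-element strictly increasing chain in P(V,V0), i.e. an (n-1)-simplex of
   the order complex; for n = 0 this is the empty simplex (augmentation), so
   the resulting chain complex is the augmented one and computes reduced
   homology. *)
Definition simplex (n : nat) (s : seq {vspace vT}) : bool :=
  [&& size s == n, all inP s & sorted ltvs s].

(* integral simplicial chains, as formal Z-linear combinations (lists of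
   coefficient/simplex pairs); two formal lists denote the same chain iff
   they have the same coefficient on every simplex *)
Definition fchain := seq (int * seq {vspace vT}).

Definition coef (c : fchain) (s : seq {vspace vT}) : int :=
  \sum_(p <- c | p.2 == s) p.1.

Definition chain_eq (c c' : fchain) : Prop := forall s, coef c s = coef c' s.

Definition chain_of (n : nat) (c : fchain) : bool :=
  all (fun p => simplex n p.2) c.

Definition face (i : nat) (s : seq {vspace vT}) := take i s ++ drop i.+1 s.

Definition bdry (c : fchain) : fchain :=
  flatten [seq [seq (((-1) ^+ i) * p.1, face i p.2) | i <- iota 0 (size p.2)]
          | p <- c].

Definition is_cycle (n : nat) (c : fchain) : Prop :=
  chain_of n c /\ forall s, coef (bdry c) s = 0.

Definition in_AT (g : 'End(vT)) : Prop :=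
  lker g = 0%VS /\ forall v, g v - v \in V0.

Definition act (g : 'End(vT)) (c : fchain) : fchain :=
  [seq (p.1, map (fun W => (g @: W)%VS) p.2) | p <- c].

Definition negc (c : fchain) : fchain := [seq (- p.1, p.2) | p <- c].

(* St(V,V0)_{A^T(V,V0)} = 0, with d = dim V0: every reduced (d-1)-cycle z is,
   up to a boundary, a finite sum of terms g.x - x with g in A^T(V,V0) and x a
   (d-1)-cycle (i.e. every class of St lies in the span of the g.x - x). *)
Definition St_coinvariants_vanish : Prop :=
  forall z : fchain, is_cycle (\dim V0) z ->
    exists (gs : seq ('End(vT) * fchain)) (b : fchain),
      (forall p, p \in gs -> in_AT p.1 /\ is_cycle (\dim V0) p.2) /\
      chain_of (\dim V0).+1 b /\
      chain_eq z (flatten [seq act p.1 p.2 ++ negc p.2 | p <- gs] ++ bdry b).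

End Steinberg.

(* Main.v *)
(* Fix a nonzero [u] in [V0].  Flags of full length in P(V,V0) are collapsed
   along the vertex where [u] enters, so a top cycle is determined by its
   coefficients on flags avoiding [u], and even by those not ending in one
   chosen hyperplane.  This identifies St(V,V0) with
   H~_0(X) (x) St(V/<u>, V0/<u>), where X is the set of hyperplanes avoiding
   [u]: every top cycle is a sum of suspensions [H] x - [H'] x.  The maps
   [v |-> v + phi v *: u] fix the second factor and act on the affine space X
   through all dilations.  For [a] other than [0] and [1], any two points
   H1, H2 of X are related by a dilation [g] of ratio [a] with some centre H0,
   whence [H2] x - [H1] x = g y - y with y = [H1] x - [H0] x.

   Chains are handled through their pairings with integral functions on
   simplices, so that identities of chains become identities of cochains. *)
Require Import Defs.
From HB Require Import structures.
From mathcomp Require Import all_boot all_order all_algebra.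
From mathcomp Require Import zify ring.
Import GRing.Theory.
Local Open Scope ring_scope.

Set Implicit Arguments.
Unset Strict Implicit.
Unset Printing Implicit Defensive.

(** * Chains paired with cochains, and prisms over a hyperplane *)

Section Pairing.
Variables (F : fieldType) (vT : vectType F).
Implicit Types (c : fchain vT) (s t : seq {vspace vT}) (H W : {vspace vT}).
Implicit Types (f : seq {vspace vT} -> int).

Definition pair f c : int := \sum_(p <- c) p.1 * f p.2.

Definition cobd f s : int :=
  \sum_(i <- iota 0 (size s)) (-1) ^+ i * f (face i s).

Lemma eq_pair f1 f2 c : {in c, forall p, f1 p.2 = f2 p.2} -> pair f1 c = pair f2 c.
Proof. by move=> e; apply: eq_big_seq => p /e ->. Qed.

Lemma pair_cat f c1 c2 : pair f (c1 ++ c2) = pair f c1 + pair f c2.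
Proof. by rewrite /pair big_cat. Qed.

Lemma pair_negc f c : pair f (negc c) = - pair f c.
Proof.
by rewrite /pair big_map -sumrN; apply: eq_bigr => p _ /=; rewrite mulNr.
Qed.

Lemma pair_act f g c :
  pair f (act g c) = pair (fun s => f (map (fun W => (g @: W)%VS) s)) c.
Proof. by rewrite /pair big_map. Qed.

Lemma pair_flatten f (cs : seq (fchain vT)) :
  pair f (flatten cs) = \sum_(c <- cs) pair f c.
Proof. by rewrite /pair big_flatten. Qed.

Lemma pair0 c : pair (fun=> 0) c = 0.
Proof. by rewrite /pair big1 // => p _; rewrite mulr0. Qed.

Lemma pairB f1 f2 c : pair (fun s => f1 s - f2 s) c = pair f1 c - pair f2 c.
Proof. by rewrite /pair -sumrB; apply: eq_bigr => p _; rewrite mulrBr. Qed.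

Lemma coef_pairE c s : coef c s = pair (fun t => (t == s)%:R) c.
Proof.
rewrite /coef /pair big_mkcond; apply: eq_bigr => p _.
by case: eqP => _; rewrite ?mulr1 ?mulr0.
Qed.

Lemma pair_coef f c :
  pair f c = \sum_(s <- undup [seq p.2 | p <- c]) coef c s * f s.
Proof.
under eq_bigr do rewrite coef_pairE mulr_suml.
rewrite exchange_big /=; apply: eq_big_seq => p pc.
rewrite (bigD1_seq p.2) ?undup_uniq ?mem_undup ?map_f //= eqxx mulr1.
by rewrite big1 ?addr0 // => s /negPf; rewrite eq_sym => ->; rewrite mulr0 mul0r.
Qed.

Lemma coef_neq0 c s : coef c s != 0 -> s \in [seq p.2 | p <- c].
Proof.
apply: contraR => sc; rewrite /coef big1_seq // => p /andP[/eqP ps pc].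
by rewrite -ps map_f in sc.
Qed.

Lemma pair_bdry f c : pair f (bdry c) = pair (cobd f) c.
Proof.
rewrite pair_flatten big_map; apply: eq_bigr => p _.
rewrite /pair big_map /cobd mulr_sumr; apply: eq_bigr => i _ /=.
by rewrite mulrCA mulrA.
Qed.

Lemma is_cycleP (V0 : {vspace vT}) n c :
  is_cycle V0 n c <-> chain_of V0 n c /\ forall f, pair (cobd f) c = 0.
Proof.
split=> -[cc c0]; split=> // f; last by rewrite coef_pairE pair_bdry.
by rewrite -pair_bdry pair_coef big1 // => s _; rewrite c0 mul0r.
Qed.

Lemma eq_cobd f1 f2 s : f1 =1 f2 -> cobd f1 s = cobd f2 s.
Proof. by move=> e; apply: eq_bigr => i _; rewrite e. Qed.

Lemma cobd_nil f : cobd f [::] = 0.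
Proof. by rewrite /cobd big_nil. Qed.

Lemma cobd_cons f W s : cobd f (W :: s) = f s - cobd (fun t => f (W :: t)) s.
Proof.
rewrite /cobd /= big_cons expr0 mul1r /face /= drop0; congr (_ + _).
rewrite (iotaDl 1%N 0%N) big_map -sumrN; apply: eq_bigr => i _ /=.
by rewrite exprS mulN1r mulNr.
Qed.

Lemma cobd_rcons f s W :
  cobd f (rcons s W) = cobd (fun t => f (rcons t W)) s + (-1) ^+ size s * f s.
Proof.
elim: s f => [|U s IHs] f /=.
  by rewrite cobd_cons !cobd_nil subr0 add0r mul1r.
by rewrite !cobd_cons IHs exprS mulN1r mulNr opprD addrA.
Qed.

Lemma cobd_map f (h : {vspace vT} -> {vspace vT}) s :
  cobd f (map h s) = cobd (fun t => f (map h t)) s.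
Proof.
elim: s f => [|W s IHs] f /=; first by rewrite !cobd_nil.
by rewrite !cobd_cons IHs.
Qed.

(* The prism from [s] down to its trace on [H], in which the vertex
   [fullv :&: H = H] remains but the improper [fullv] is dropped. *)
Fixpoint prism H s : fchain vT :=
  if s is W :: s' then
    (1, (W :&: H)%VS :: s) :: [seq (- p.1, (W :&: H)%VS :: p.2) | p <- prism H s']
  else [:: (1, [:: H])].

Definition prismc H c : fchain vT :=
  flatten [seq [seq (p.1 * q.1, q.2) | q <- prism H p.2] | p <- c].

Lemma pair_prismc f H c : pair f (prismc H c) = pair (fun s => pair f (prism H s)) c.
Proof.
rewrite pair_flatten big_map; apply: eq_bigr => p _.
by rewrite /pair big_map mulr_sumr; apply: eq_bigr => q _; rewrite mulrA.
Qed.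

Lemma pair_prism_nil f H : pair f (prism H [::]) = f [:: H].
Proof. by rewrite /pair big_seq1 mul1r. Qed.

Lemma pair_prism_cons f H W s :
  pair f (prism H (W :: s)) =
  f [:: (W :&: H)%VS, W & s] - pair (fun t => f ((W :&: H)%VS :: t)) (prism H s).
Proof.
rewrite /pair /= big_cons mul1r big_map -sumrN.
by congr (_ + _); apply: eq_bigr => p _; rewrite mulNr.
Qed.

(** The traces on [H] cancel, since the prism also cones them off to [H]; so the prism acts as a
    contracting homotopy. *)
Lemma pair_cobd_prism f H s :
  pair (cobd f) (prism H s) = f s - cobd (fun t => pair f (prism H t)) s.
Proof.
elim: s f => [|W s IHs] f.
  by rewrite pair_prism_nil cobd_cons !cobd_nil.
rewrite pair_prism_cons.
rewrite (eq_pair (f2 := fun t => f t - cobd (fun r => f ((W :&: H)%VS :: r)) t));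
  last by move=> p _; rewrite cobd_cons.
rewrite pairB IHs !cobd_cons.
have -> : cobd (fun t => pair f (prism H (W :: t))) s =
   cobd (fun t => f [:: (W :&: H)%VS, W & t]) s
   - cobd (fun t => pair (fun r => f ((W :&: H)%VS :: r)) (prism H t)) s.
  rewrite /cobd -sumrB; apply: eq_bigr => i _.
  by rewrite pair_prism_cons mulrBr.
ring.
Qed.

(** Both prisms have boundary [c], so their difference is the suspension of [c] with poles [H1] and
    [H2]. *)
Lemma pair_cobd_prismB H1 H2 c : (forall f, pair (cobd f) c = 0) ->
  forall f, pair (cobd f) (prismc H1 c ++ negc (prismc H2 c)) = 0.
Proof.
move=> c0 f; rewrite pair_cat pair_negc !pair_prismc.
have E H : pair (fun s => pair (cobd f) (prism H s)) c = pair f c.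
  rewrite -[RHS]subr0 -(c0 (fun s => pair f (prism H s))) -pairB.
  by apply: eq_pair => p _; apply: pair_cobd_prism.
by rewrite !E subrr.
Qed.

End Pairing.

(** * Flags of full length and the boundary of a top chain *)

Section Flags.
Variables (F : fieldType) (vT : vectType F) (V0 : {vspace vT}).
Implicit Types (c : fchain vT) (s t : seq {vspace vT}) (U W H : {vspace vT}).
Implicit Types (f : seq {vspace vT} -> int).

Local Notation n := (\dim {:vT}).
Local Notation d := (\dim V0).

Lemma ltvs_dim U W : ltvs U W -> (\dim U < \dim W)%N.
Proof.
case/andP=> sUW neq; rewrite ltn_neqAle dimvS // andbT.
by apply: contra neq => /eqP e; rewrite eqEdim sUW e leqnn.
Qed.

Lemma ltvs_trans : transitive (@ltvs F vT).
Proof.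
move=> W U X UW WX; rewrite /ltvs; case/andP: (UW) => sUW _; case/andP: (WX) => sWX _.
rewrite (subv_trans sUW sWX); apply/eqP=> UX.
by have := ltn_trans (ltvs_dim UW) (ltvs_dim WX); rewrite UX ltnn.
Qed.

Lemma inP_dim W : inP V0 W -> (n - d <= \dim W < n)%N.
Proof.
case/andP=> WV /eqP WV0; apply/andP; split.
  by rewrite leq_subLR addnC -WV0; apply: (leqif_trans (dimv_add_leqif _ _) _).
rewrite ltn_neqAle dimvS ?subvf // andbT.
by apply: contra WV => /eqP e; rewrite eqEdim subvf e leqnn.
Qed.

(** The [d] dimensions increase strictly inside an interval of [d] integers, hence exhaust it. *)
Lemma flag_dims s : simplex V0 d s -> [seq \dim W | W <- s] = iota (n - d) d.
Proof.
case/and3P=> /eqP sz inPs srt.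
have srtd : sorted ltn [seq \dim W | W <- s].
  by rewrite sorted_map; apply: sub_sorted srt => U W /ltvs_dim.
apply: (irr_sorted_eq ltn_trans ltnn srtd (iota_ltn_sorted _ _)).
have sub : {subset [seq \dim W | W <- s] <= iota (n - d) d}.
  move=> _ /mapP[W /(allP inPs)/inP_dim + ->]; rewrite mem_iota.
  by have := dimvS (subvf V0); lia.
have [|//] := uniq_min_size (sorted_uniq ltn_trans ltnn srtd) sub.
by rewrite size_map size_iota sz.
Qed.

Lemma flag_dim s1 W s2 : simplex V0 d (s1 ++ W :: s2) ->
  \dim W = (n - d + size s1)%N.
Proof.
move=> sp; have /and3P[/eqP sz _ _] := sp.
have := congr1 (nth 0%N ^~ (size s1)) (flag_dims sp).
rewrite map_cat nth_cat size_map ltnn subnn /= nth_iota //.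
by move: sz; rewrite size_cat /=; lia.
Qed.

Lemma face_cat s1 W s2 : face (size s1) (s1 ++ W :: s2) = s1 ++ s2.
Proof.
by rewrite /face take_size_cat // -cat_rcons drop_size_cat // size_rcons.
Qed.

(** A flag has one vertex in each dimension, so the dimension missing from a face tells which vertex
    was deleted. *)
Lemma face_flag i s s1 W s2 : simplex V0 d s -> simplex V0 d (s1 ++ W :: s2) ->
  (i < d)%N -> face i s = s1 ++ s2 -> i = size s1.
Proof.
move=> sp sp' id e; have /and3P[/eqP sz _ _] := sp'.
rewrite size_cat /= in sz.
have E : face i s = face (size s1) (s1 ++ W :: s2) by rewrite face_cat.
have szs : size s = d by case/and3P: sp => /eqP.
apply/eqP; rewrite eqn_leq; apply/andP.
have nthd r j x : simplex V0 d r -> (j < d)%N -> \dim (nth x r j) = (n - d + j)%N.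
  move=> sr jd; have /and3P[/eqP szr _ _] := sr.
  by rewrite -(nth_map x 0%N) ?szr // flag_dims // nth_iota.
have nthf r j k x : size r = d -> (j < d)%N ->
    nth x (face j r) k = nth x r (if (k < j)%N then k else k.+1).
  move=> szr jd; rewrite /face nth_cat size_take szr jd.
  by case: ltnP => kj; rewrite ?nth_take // nth_drop; congr nth; lia.
have szs' : size (s1 ++ W :: s2) = d by case/and3P: sp' => /eqP.
split; rewrite leqNgt; apply/negP => lt.
- have := congr1 (fun r => \dim (nth fullv r (size s1))) E.
  rewrite /= !nthf ?lt ?ltnn ?szs' //; last lia.
  rewrite !nthd //; lia.
- have := congr1 (fun r => \dim (nth fullv r i)) E.
  rewrite /= !nthf ?lt ?ltnn ?szs' //; last lia.
  rewrite !nthd //; lia.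
Qed.

(** The boundary coefficient at [s1 ++ s2] is, up to sign, the sum of the coefficients of all its
    completions by one vertex after [s1]; if all but one of these vanish, so does the last. *)
Lemma coef_unique_completion c s1 s2 W0 : is_cycle V0 d c ->
  (forall W, W != W0 -> coef c (s1 ++ W :: s2) = 0) ->
  coef c (s1 ++ W0 :: s2) = 0.
Proof.
set s0 := s1 ++ W0 :: s2; case/is_cycleP=> cc c0 uniqW.
apply/eqP/negPn/negP => nz; have sc := coef_neq0 nz.
have sp s : s \in [seq p.2 | p <- c] -> simplex V0 d s.
  by case/mapP=> p /(allP cc) + ->.
have sp0 := sp _ sc; have /and3P[/eqP sz0 _ _] := sp0.
have ltd : (size s1 < d)%N by rewrite -sz0 size_cat /=; lia.
have cobdE s : s \in [seq p.2 | p <- c] ->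
    cobd (fun t => (t == s1 ++ s2)%:R) s =
    (-1) ^+ size s1 * (face (size s1) s == s1 ++ s2)%:R.
  move=> /sp sps; have /and3P[/eqP szs _ _] := sps.
  rewrite /cobd (bigD1_seq (size s1)) ?iota_uniq ?mem_iota ?szs //=.
  rewrite big1_seq ?addr0 // => i /andP[ni]; rewrite mem_iota /= => id.
  case: eqP => [/(face_flag sps sp0 id) e|]; last by rewrite mulr0.
  by rewrite e eqxx in ni.
have := c0 (fun t => (t == s1 ++ s2)%:R); rewrite pair_coef.
rewrite (bigD1_seq s0) ?undup_uniq ?mem_undup //= cobdE // face_cat eqxx mulr1.
rewrite big1_seq ?addr0 => [/eqP|s /andP[ns]].
  by rewrite mulf_eq0 (negPf nz) signr_eq0.
rewrite mem_undup => s_c; rewrite cobdE //; case: eqP => [e|]; last by rewrite !mulr0.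
have /and3P[/eqP szs _ _] := sp _ s_c.
have [W defs] : exists W, s = s1 ++ W :: s2.
  exists (nth W0 s (size s1)).
  rewrite -{1}(cat_take_drop (size s1) s) (drop_nth W0) ?szs //.
  move/eqP: e; rewrite /face eqseq_cat; last by rewrite size_takel ?szs ?(ltnW ltd).
  by case/andP=> /eqP -> /eqP ->.
rewrite defs uniqW ?mul0r //; apply: contra ns => /eqP WW0.
by rewrite defs WW0.
Qed.

End Flags.

(** * Complements of the line of [u] and the dilations acting on them *)

Section Transversal.
Variables (F : fieldType) (vT : vectType F) (u : vT).
Hypothesis nzu : u != 0.
Implicit Types (W H : {vspace vT}).

Local Notation n := (\dim {:vT}).

Definition transverse H := (u \notin H) && ((<[u]> + H)%VS == fullv).

Lemma capv_line0 H : u \notin H -> (<[u]> :&: H = 0)%VS.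
Proof.
move=> uH; apply/eqP; rewrite -subv0; apply/subvP => v /memv_capP[/vlineP[k ->]].
have [-> _|nzk] := eqVneq k 0; first by rewrite scale0r mem0v.
by rewrite rpredZeq (negPf nzk) (negPf uH).
Qed.

Lemma dimv_add_line H : u \notin H -> \dim (<[u]> + H) = (\dim H).+1.
Proof.
move=> uH; have := dimv_sum_cap <[u]> H.
by rewrite capv_line0 // dimv0 addn0 dim_vline nzu.
Qed.

Lemma dim_transverse H : transverse H -> (\dim H).+1 = n.
Proof. by case/andP=> uH /eqP <-; rewrite dimv_add_line. Qed.

Lemma transverse_dim H : u \notin H -> (\dim H).+1 = n -> transverse H.
Proof. by move=> uH dH; rewrite /transverse uH eqEdim subvf dimv_add_line // dH /=. Qed.

Lemma cap_transverse_dim H W : transverse H -> u \in W ->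
  (\dim (W :&: H)).+1 = \dim W.
Proof.
move=> tH uW; have dH := dim_transverse tH; case/andP: tH => uH /eqP sH.
have := dimv_sum_cap W H; suff -> : (W + H = fullv)%VS by lia.
by apply/eqP; rewrite eqEsubv subvf -sH addvS // -memvE.
Qed.

(** Together with [add_line_capK]: subspaces containing [u] correspond to subspaces of [H] by
    intersecting with [H] and adding [u]. *)
Lemma cap_transverseK H W : transverse H -> u \in W -> (<[u]> + W :&: H)%VS = W.
Proof.
move=> tH uW; apply/eqP; rewrite eqEdim subv_add -memvE uW capvSl /=.
rewrite dimv_add_line ?cap_transverse_dim //.
by rewrite memv_cap negb_and; case/andP: tH => ->; rewrite orbT.
Qed.

Lemma add_line_capK H W : transverse H -> (W <= H)%VS -> ((<[u]> + W) :&: H)%VS = W.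
Proof.
move=> tH sWH; have /andP[uH _] := tH.
have uW : u \notin W by apply: contra uH => /(subvP sWH).
apply/eqP; rewrite eq_sym eqEdim subv_cap addvSr sWH /=.
rewrite -ltnS cap_transverse_dim ?dimv_add_line //.
by apply: (subvP (addvSl _ _)); apply: memv_line.
Qed.

Lemma transverse_proj H : transverse H ->
  exists p : 'End(vT), [/\ p u = u, forall v, p v \in <[u]>%VS,
    forall v, v - p v \in H & {in H, forall v, p v = 0}].
Proof.
case/andP=> /capv_line0 c0 /eqP sH; exists (daddv_pi <[u]> H).
have E v : daddv_pi <[u]> H v + daddv_pi H <[u]> v = v.
  by apply: daddv_pi_add; rewrite ?sH ?memvf.
split=> [|v|v|v vH]; first by rewrite daddv_pi_id ?memv_line.
- exact: memv_pi.
- by rewrite -{1}(E v) addrC addKr memv_pi.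
apply: (addIr (daddv_pi H <[u]> v)); rewrite E add0r daddv_pi_id //.
by rewrite capvC.
Qed.

(* Hyperplanes transverse to [u] form an affine space, on which the maps
   [v |-> v + phi v *: u] act by dilations; given two of its points, take the
   dilation of ratio [a] moving one to the other, whose centre is
   [ker (a p1 - p2)] for the projections [p1], [p2] onto [u]. *)
Lemma transverse_dilation (a : F) H1 H2 : a != 0 -> a != 1 ->
    transverse H1 -> transverse H2 ->
  exists (g : 'End(vT)) (H0 : {vspace vT}), [/\ lker g = 0%VS,
    forall v, g v - v \in <[u]>%VS, transverse H0, (g @: H0 = H0)%VS &
    (g @: H1 = H2)%VS].
Proof.
move=> a0 a1 t1 t2.
have [p1 [p1u p1l p1H p1K]] := transverse_proj t1.
have [p2 [p2u p2l p2H p2K]] := transverse_proj t2.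
(* [g] multiplies [u] by [a], so it is injective; on [H1] it is [v - p2 v], which lies in [H2]; on
   [lker q] it is the identity. *)
pose q : 'End(vT) := a *: p1 - p2; pose g : 'End(vT) := (\1 + q)%VF.
have qE v : q v = a *: p1 v - p2 v by rewrite add_lfunE opp_lfunE scale_lfunE.
have gE v : g v = v + q v by rewrite add_lfunE id_lfunE.
have qu : q u = (a - 1) *: u by rewrite qE p1u p2u scalerBl scale1r.
have ql v : q v \in <[u]>%VS by rewrite qE rpredB ?rpredZ.
have qq v : q (q v) = (a - 1) *: q v.
  by have /vlineP[k ->] := ql v; rewrite linearZ /= qu !scalerA mulrC.
have kg : lker g = 0%VS.
  apply/eqP; rewrite -subv0; apply/subvP => v; rewrite memv_ker gE memv0.
  rewrite addr_eq0 => /eqP vE.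
  have /vlineP[k kE] : v \in <[u]>%VS by rewrite vE rpredN.
  move: vE; rewrite kE linearZ /= qu => /eqP.
  rewrite -addr_eq0 scalerA -scalerDl scaler_eq0 (negPf nzu) orbF.
  rewrite mulrBr mulr1 addrC subrK mulf_eq0 (negPf a0) orbF => /eqP ->.
  by rewrite scale0r.
have img (U W : {vspace vT}) :
    (forall v, v \in U -> g v \in W) -> \dim U = \dim W -> (g @: U = W)%VS.
  move=> sub dUW; apply/eqP; rewrite eqEdim limg_dim_eq ?kg ?capv0 // dUW leqnn andbT.
  by apply/subvP => _ /memv_imgP[v vU ->]; apply: sub.
exists g, (lker q); split=> // [v|||].
- by rewrite gE addrC addKr.
- rewrite /transverse memv_ker qu scaler_eq0 (negPf nzu) subr_eq0 (negPf a1) /=.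
  (* As [q] multiplies [u] by [a - 1], dividing it by [a - 1] gives the projection onto the line
     along [lker q]. *)
  rewrite eqEsubv subvf; apply/subvP => v _; pose w := (a - 1)^-1 *: q v.
  have wl : w \in <[u]>%VS by rewrite rpredZ.
  have kv : v - w \in lker q.
    rewrite memv_ker linearB linearZ /= qq scalerA mulVf ?subr_eq0 //.
    by rewrite scale1r.
  by have := memv_add wl kv; rewrite addrC subrK.
- by apply: img => // v; rewrite memv_ker => vq; rewrite gE (eqP vq) addr0 memv_ker.
- apply: img => [v vH|]; last first.
    by apply: succn_inj; rewrite (dim_transverse t1) (dim_transverse t2).
  by rewrite gE qE p1K // scaler0 sub0r.
Qed.

Lemma lfun_img_line_mod g W : lker g = 0%VS -> (forall v, g v - v \in <[u]>%VS) ->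
  u \in W -> (g @: W)%VS = W.
Proof.
move=> kg gl uW; apply/eqP; rewrite eqEdim limg_dim_eq ?kg ?capv0 // leqnn andbT.
apply/subvP => _ /memv_imgP[v vW ->]; rewrite -(subrK v (g v)) rpredD //.
by apply: subvP (gl v); rewrite -memvE.
Qed.

End Transversal.

(** * Top cycles determined by their coefficients on few flags *)

Section Rigidity.
Variables (F : fieldType) (vT : vectType F) (V0 : {vspace vT}) (u : vT).
Hypotheses (nzu : u != 0) (V0u : u \in V0).
Implicit Types (c : fchain vT) (s t : seq {vspace vT}) (A B W H : {vspace vT}).

Local Notation n := (\dim {:vT}).
Local Notation d := (\dim V0).

Lemma dim_V0 : (0 < d <= n)%N.
Proof.
rewrite dimvS ?subvf // andbT lt0n dimv_eq0.
by apply: contra nzu => /eqP V00; move: V0u; rewrite V00 memv0.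
Qed.

(** The first vertex has dimension [n - d], so it is a complement of [V0] and misses [u]. *)
Lemma flag_head_notin W s : simplex V0 d (W :: s) -> u \notin W.
Proof.
move=> sp; have dW := flag_dim (s1 := [::]) sp.
have /and3P[_ /= /andP[/andP[_ /eqP WV0] _] _] := sp.
have := dimv_sum_cap W V0; rewrite WV0 dW addn0 => E.
apply/negP => uW; have : u \in (W :&: V0)%VS by rewrite memv_cap uW.
have /eqP : \dim (W :&: V0) = 0%N by have := dim_V0; lia.
by rewrite dimv_eq0 => /eqP ->; rewrite memv0 (negPf nzu).
Qed.

Lemma flag_last_dim s H : simplex V0 d (rcons s H) -> (\dim H).+1 = n.
Proof.
rewrite -cats1 => sp; rewrite (flag_dim sp).
have /and3P[/eqP + _ _] := sp; rewrite size_cat /=; have := dim_V0; lia.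
Qed.

Lemma flag_next_le s1 A B s2 : simplex V0 d (s1 ++ [:: A, B & s2]) -> (A <= B)%VS.
Proof.
case/and3P=> _ _; case: s1 => [|W s1] /=; first by case/andP=> /andP[].
by rewrite cat_path /= => /and3P[_ _ /andP[/andP[]]].
Qed.

(** Dimensions go up by one along a flag, so the vertex where [u] enters is forced by its
    predecessor. *)
Lemma flag_enter s1 A B s2 : simplex V0 d (s1 ++ [:: A, B & s2]) ->
  u \notin A -> u \in B -> B = (<[u]> + A)%VS.
Proof.
move=> sp uA uB; apply/eqP; rewrite eq_sym eqEdim subv_add -memvE uB.
rewrite (flag_next_le sp) dimv_add_line // (flag_dim sp).
by move: sp; rewrite -cat_rcons => /flag_dim ->; rewrite size_rcons addnS /=.
Qed.

Lemma flag_split s : sorted (@ltvs F vT) s ->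
  exists r t, [/\ s = r ++ t, all (fun W => u \notin W) r &
    all (fun W : {vspace vT} => u \in W) t].
Proof.
elim: s => [|W s IHs] srt; first by exists [::], [::].
have [uW|uW] := boolP (u \in W).
  exists [::], (W :: s); split=> //=; rewrite uW.
  have := order_path_min (@ltvs_trans F vT) srt.
  by apply: sub_all => U /andP[/subvP sWU _]; apply: sWU.
have [r [t [-> ar at_]]] := IHs (path_sorted srt).
by exists (W :: r), t; split=> //=; rewrite uW.
Qed.

(* [outside] is a downward induction on the number of vertices avoiding [u];
   [all0] is an upward one, which starts because the first vertex of a flag
   meets [V0] trivially.  Each step refills one vertex in a unique way. *)
Lemma top_cycle_eq0 c H0 : transverse u H0 -> is_cycle V0 d c ->
  (forall s H, u \notin H -> H != H0 -> coef c (rcons s H) = 0) ->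
  forall s, coef c s = 0.
Proof.
move=> t0 cyc van.
have nz_simplex s : coef c s != 0 -> simplex V0 d s.
  by case: cyc => cc _ /coef_neq0/mapP[p /(allP cc) + ->].
have outside t : all (fun W => u \in W) t -> forall r A, u \notin A ->
    ~~ (A <= H0)%VS -> coef c (r ++ A :: t) = 0.
  elim: t => [_|B t IHt /= /andP[uB ut]] r A uA AH.
    by rewrite cats1 van //; apply: contra AH => /eqP ->.
  have [//|/nz_simplex spB] := eqVneq (coef c (r ++ [:: A, B & t])) 0.
  (* Refill the place of [B]: a vertex containing [u] is forced to be [B], and one avoiding [u]
     still lies outside [H0] because it contains [A]. *)
  rewrite -cat_rcons; apply: (coef_unique_completion cyc) => W.
  apply: contraNeq; rewrite cat_rcons => nzW; have spW := nz_simplex _ nzW.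
  have [uW|uW] := boolP (u \in W).
    by rewrite (flag_enter spW) // (flag_enter spB).
  case/eqP: nzW; rewrite -cat_rcons IHt //.
  by apply: contra AH; apply: subv_trans (flag_next_le spW).
have all0 r : all (fun W => u \notin W) r -> forall t,
    all (fun W : {vspace vT} => u \in W) t -> coef c (r ++ t) = 0.
  elim/last_ind: r => [_|r A IHr]; first move=> t ut.
    apply/eqP; apply: contraT => /nz_simplex /=; case: t ut => [|W t] /=.
      by move=> _ /and3P[/eqP d0 _ _]; have := dim_V0; rewrite -d0.
    by case/andP=> uW _ /flag_head_notin; rewrite uW.
  rewrite all_rcons => /andP[uA ur] t ut; rewrite cat_rcons.
  have [AH|AH] := boolP (A <= H0)%VS; last exact: outside.
  have [//|/nz_simplex spA] := eqVneq (coef c (r ++ A :: t)) 0.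
  (* Refill the place of [A]: [IHr] excludes vertices containing [u] and [outside] those not inside
     [H0]; what is left is [H0] itself at the end of the flag, and [B :&: H0] before a vertex
     [B]. *)
  apply: (coef_unique_completion cyc) => W.
  apply: contraNeq => nzW; have spW := nz_simplex _ nzW.
  have [uW|uW] := boolP (u \in W).
    by case/eqP: nzW; rewrite IHr //= uW.
  have [WH|WH] := boolP (W <= H0)%VS; last by case/eqP: nzW; apply: outside.
  case: t ut spA spW {nzW} => [_|B t /= /andP[uB _]] spA spW.
    rewrite !cats1 in spA spW.
    have dA := flag_last_dim spA; have dW := flag_last_dim spW.
    have dH := dim_transverse nzu t0.
    have /eqP -> : W == H0 by rewrite eqEdim WH -ltnS dW dH /=.
    by rewrite eq_sym eqEdim AH -ltnS dA dH /=.
  have dB : \dim B = (\dim A).+1.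
    rewrite (flag_dim spA); move: spA; rewrite -cat_rcons => /flag_dim ->.
    by rewrite size_rcons addnS.
  have dW : \dim W = \dim A by rewrite (flag_dim spA) (flag_dim spW).
  have dBH := cap_transverse_dim nzu t0 uB.
  have trace U : (U <= B)%VS -> (U <= H0)%VS -> \dim U = \dim A -> U = (B :&: H0)%VS.
    by move=> UB UH dU; apply/eqP; rewrite eqEdim subv_cap UB UH -ltnS dBH dB dU /=.
  by rewrite (trace W) ?(flag_next_le spW) // -(trace A) ?(flag_next_le spA).
move=> s; have [//|/nz_simplex/and3P[_ _ srt]] := eqVneq (coef c s) 0.
by have [r [t [-> ur ut]]] := flag_split srt; apply: all0.
Qed.

End Rigidity.

(** * Suspensions of cycles living above [u], and links of hyperplanes *)

Section Suspension.
Variables (F : fieldType) (vT : vectType F) (V0 : {vspace vT}) (u : vT).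
Hypotheses (nzu : u != 0) (V0u : u \in V0).
Implicit Types (c x z : fchain vT) (s t : seq {vspace vT}) (A B W H : {vspace vT}).
Implicit Types (f : seq {vspace vT} -> int).

Local Notation n := (\dim {:vT}).
Local Notation d := (\dim V0).

Lemma chain_of_cat m c1 c2 :
  chain_of V0 m (c1 ++ c2) = chain_of V0 m c1 && chain_of V0 m c2.
Proof. exact: all_cat. Qed.

Lemma chain_of_negc m c : chain_of V0 m (negc c) = chain_of V0 m c.
Proof. exact: all_map. Qed.

Lemma chain_of_flatten m (cs : seq (fchain vT)) :
  chain_of V0 m (flatten cs) = all (chain_of V0 m) cs.
Proof. by elim: cs => //= c cs IHcs; rewrite chain_of_cat IHcs. Qed.

Lemma transverse_inP H : transverse u H -> inP V0 H.
Proof.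
case/andP=> uH /eqP sH; rewrite /inP; apply/andP; split.
  by apply: contra uH => /eqP ->; rewrite memvf.
by rewrite eqEsubv subvf -sH addvC addvS // -memvE.
Qed.

Lemma cap_transverse_inP H W : transverse u H -> u \in W -> inP V0 W ->
  inP V0 (W :&: H)%VS.
Proof.
move=> tH uW /andP[_ /eqP sW]; have /andP[uH _] := tH.
rewrite /inP; apply/andP; split.
  by apply: contra uH => /eqP e; apply: (subvP (capvSr W H)); rewrite e memvf.
rewrite eqEsubv subvf -sW -{1}(cap_transverseK nzu tH uW) -addvA.
by rewrite subv_add subvv andbT -memvE (subvP (addvSr _ _)).
Qed.

Lemma ltvs_cap H W : transverse u H -> u \in W -> ltvs (W :&: H)%VS W.
Proof.
case/andP=> uH _ uW; rewrite /ltvs capvSl /=.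
by apply: contra uH => /eqP e; apply: (subvP (capvSr W H)); rewrite e.
Qed.

Lemma ltvs_cap2 H A B : transverse u H -> u \in A -> u \in B -> ltvs A B ->
  ltvs (A :&: H)%VS (B :&: H)%VS.
Proof.
move=> tH uA uB /andP[AB neq]; rewrite /ltvs capvS //=.
apply: contra neq => /eqP e.
by rewrite -(cap_transverseK nzu tH uA) e (cap_transverseK nzu tH uB).
Qed.

Lemma ltvs_cap_top H W : transverse u H -> u \in W -> inP V0 W ->
  ltvs (W :&: H)%VS H.
Proof.
move=> tH uW /andP[WV _]; rewrite /ltvs capvSr /=; apply: contra WV => /eqP e.
by rewrite -(cap_transverseK nzu tH uW) e; case/andP: tH.
Qed.

(** Traces stay strictly increasing because a subspace containing [u] is recovered from its trace on
    [H]. *)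
Lemma prism_path H A s : transverse u H -> all (inP V0) (A :: s) ->
    all (fun W : {vspace vT} => u \in W) (A :: s) -> path (@ltvs F vT) A s ->
  {in prism H s, forall p, path (@ltvs F vT) (A :&: H)%VS p.2}.
Proof.
move=> tH; elim: s A => [|B s IHs] A /=.
  rewrite !andbT => PA uA _ p; rewrite inE => /eqP -> /=.
  by rewrite andbT ltvs_cap_top.
move=> /and3P[PA PB Ps] /and3P[uA uB us] /andP[AB Bs] p.
rewrite inE => /predU1P[-> | /mapP[q qs ->]] /=.
  by rewrite ltvs_cap2 ?ltvs_cap.
by rewrite ltvs_cap2 ?IHs //= ?PB ?uB.
Qed.

Lemma prism_chain H s : transverse u H -> all (inP V0) s ->
    all (fun W : {vspace vT} => u \in W) s -> sorted (@ltvs F vT) s ->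
  chain_of V0 (size s).+1 (prism H s).
Proof.
move=> tH Ps us ss; apply/allP => p ps; apply/and3P; split.
- elim: s p {Ps us ss} ps => [|W s IHs] p /=; rewrite inE; first by move/eqP->.
  by case/predU1P=> [-> //|/mapP[q /IHs /eqP qs ->]] /=; rewrite qs.
- elim: s p Ps us {ss} ps => [|W s IHs] p /=; rewrite inE.
    by move=> _ _ /eqP -> /=; rewrite transverse_inP.
  case/andP=> PW Ps /andP[uW us].
  case/predU1P=> [->|/mapP[q /IHs qs ->]] /=; first by rewrite cap_transverse_inP ?PW.
  by rewrite cap_transverse_inP ?qs.
case: s Ps us ss ps => [|W s] /=; rewrite inE; first by move=> _ _ _ /eqP ->.
move=> PWs uWs ss; have /andP[uW _] := uWs.
case/predU1P=> [->|/mapP[q qs ->]] /=; first by rewrite ltvs_cap.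
exact: (prism_path tH PWs uWs ss qs).
Qed.

(** Chains of [P(V,V0)] with this property are chains of the copy of [P(V/<u>,V0/<u>)] inside it. *)
Definition over_u x := all (fun p => all (fun W : {vspace vT} => u \in W) p.2) x.

Lemma prismc_chain m H x : transverse u H -> over_u x -> chain_of V0 m x ->
  chain_of V0 m.+1 (prismc H x).
Proof.
move=> tH ux cx; rewrite chain_of_flatten all_map; apply/allP => p px /=.
rewrite /chain_of all_map.
have /and3P[/eqP <- Ps ss] := allP cx p px.
exact: prism_chain tH Ps (allP ux p px) ss.
Qed.

(** [g] is the identity modulo [u], so it fixes every vertex containing [u] and a prism changes only
    through its pole [H]. *)
Lemma pair_prism_img f g H s : lker g = 0%VS ->
    (forall v, g v - v \in <[u]>%VS) -> all (fun W : {vspace vT} => u \in W) s ->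
  pair (fun t => f (map (fun W => (g @: W)%VS) t)) (prism H s) =
  pair f (prism (g @: H)%VS s).
Proof.
move=> kg gl; elim: s f => [|W s IHs] f /=; first by rewrite !pair_prism_nil.
case/andP=> uW us; rewrite !pair_prism_cons.
have gW : (g @: (W :&: H) = W :&: g @: H)%VS.
  by rewrite lker0_img_cap ?kg // (lfun_img_line_mod kg gl uW).
rewrite -IHs //= gW (lfun_img_line_mod kg gl uW).
congr (f [:: _, _ & _] - _); elim: s us {IHs} => //= B s IHs /andP[uB us].
by rewrite IHs // (lfun_img_line_mod kg gl uB).
Qed.

Lemma susp_coinvariant (a : F) x H1 H2 : a != 0 -> a != 1 ->
    transverse u H1 -> transverse u H2 -> over_u x -> is_cycle V0 d.-1 x ->
  exists (g : 'End(vT)) y, [/\ in_AT V0 g, is_cycle V0 d y &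
    forall f, pair f (act g y ++ negc y) =
              pair f (prismc H2 x) - pair f (prismc H1 x)].
Proof.
move=> a0 a1 t1 t2 ux /is_cycleP[cx x0].
have [g [H0 [kg gl t0 gH0 gH1]]] := transverse_dilation nzu a0 a1 t1 t2.
have dE : d.-1.+1 = d by have /andP[+ _] := dim_V0 nzu V0u; case: (d).
(* [H0] is the centre of the dilation, so the prisms over it cancel in [g y - y]. *)
exists g, (prismc H1 x ++ negc (prismc H0 x)); split.
- by split=> // v; apply: subvP (gl v); rewrite -memvE.
- apply/is_cycleP; split; last exact: pair_cobd_prismB.
  by rewrite chain_of_cat chain_of_negc -dE !prismc_chain.
move=> f; have actE H : pair f (act g (prismc H x)) = pair f (prismc (g @: H)%VS x).
  rewrite pair_act !pair_prismc; apply: eq_pair => p px.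
  by apply: pair_prism_img => //; apply: (allP ux).
rewrite pair_cat pair_negc {1}/act map_cat -/(act g _) -/(act g _) !pair_cat.
have -> : act g (negc (prismc H0 x)) = negc (act g (prismc H0 x)).
  by rewrite /act /negc -!map_comp.
rewrite !pair_negc !actE gH0 gH1; ring.
Qed.

(** Every simplex of the prism but the last ends in a vertex containing [u], where [f] vanishes; the
    last one collects a sign per vertex of [s]. *)
Lemma pair_prism_top f H s : (forall t B, u \in B -> f (rcons t B) = 0) ->
    all (fun W : {vspace vT} => u \in W) s ->
  pair f (prism H s) =
  (-1) ^+ size s * f (rcons [seq (W :&: H)%VS | W <- s] H).
Proof.
elim: s f => [|W s IHs] f f0 /=; first by rewrite pair_prism_nil mul1r.
move=> /andP[uW us]; rewrite pair_prism_cons IHs //; last first.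
  by move=> t B uB; rewrite -rcons_cons f0.
have uL : u \in last W s.
  by have := mem_last W s; rewrite inE => /predU1P[-> //|/(allP us)].
by rewrite lastI -rcons_cons f0 // sub0r exprS mulN1r mulNr.
Qed.

Definition butlast s := rev (behead (rev s)).

Lemma butlast_rcons s W : butlast (rcons s W) = s.
Proof. by rewrite /butlast rev_rcons /= revK. Qed.

(* The sign makes [prismc H (link H z)] agree with [z] on the flags ending
   in [H], see [pair_prism_top]. *)
Definition link H z : fchain vT :=
  [seq ((-1) ^+ d.-1 * p.1, [seq (<[u]> + W)%VS | W <- butlast p.2])
  | p <- z & last fullv p.2 == H].

Lemma pair_link f H z : pair f (link H z) =
  pair (fun s => (-1) ^+ d.-1 * (last fullv s == H)%:R *
                 f [seq (<[u]> + W)%VS | W <- butlast s]) z.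
Proof.
rewrite /pair big_map big_filter big_mkcond; apply: eq_bigr => p _ /=.
by case: eqP => _; rewrite ?mulr0 ?mul0r ?mulr0 // mulr1; ring.
Qed.

Lemma flagP z p : chain_of V0 d z -> p \in z -> exists r K,
  [/\ p.2 = rcons r K, simplex V0 d (rcons r K) & size r = d.-1].
Proof.
move=> /allP cz pz; have := cz p pz; have /andP[d0 _] := dim_V0 nzu V0u.
case/lastP: (p.2) => [|r K] sp.
  by case/and3P: sp => /eqP /= e; rewrite -e in d0.
exists r, K; split=> //; case/and3P: sp => /eqP <- _ _.
by rewrite size_rcons.
Qed.

Lemma flag_below r K : simplex V0 d (rcons r K) -> {in r, forall W, ltvs W K}.
Proof.
case/and3P=> _ _; rewrite sorted_pairwise; last exact: ltvs_trans.
by rewrite pairwise_rcons => /andP[/allP].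
Qed.

Lemma link_over H z : over_u (link H z).
Proof.
rewrite /over_u all_map; apply/allP => p _ /=; rewrite all_map.
apply/allP => W _ /=; apply: (subvP (addvSl _ _)); exact: memv_line.
Qed.

(** Deleting a vertex before the last commutes with passing to the link; deleting the last leaves a
    sequence that does not end in [H]. *)
Lemma link_cycle H z : transverse u H -> is_cycle V0 d z ->
  is_cycle V0 d.-1 (link H z).
Proof.
move=> tH /is_cycleP[cz z0]; apply/is_cycleP; split=> [|f].
  rewrite /chain_of all_map; apply/allP => p; rewrite mem_filter /=.
  case/andP=> /eqP lp pz; have [r [K [pE sp szr]]] := flagP cz pz.
  rewrite pE last_rcons in lp; rewrite {}lp in sp pE; rewrite pE butlast_rcons.
  have lt := flag_below sp; have /and3P[_ inPr srt] := sp.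
  (* Adding [u] loses nothing below [H]: intersecting with [H] recovers [W], so properness and
     strict inclusions survive. *)
  have capK W : W \in r -> ((<[u]> + W) :&: H)%VS = W.
    by move=> /lt/andP[WH _]; apply: add_line_capK.
  apply/and3P; split; first by rewrite size_map szr.
  - rewrite all_map; apply/allP => W Wr /=; rewrite /inP; apply/andP; split.
      have /andP[_] := lt _ Wr; apply: contra => /eqP e.
      by rewrite -(capK _ Wr) e capfv.
    move: inPr; rewrite all_rcons => /andP[_ /allP/(_ _ Wr)/andP[_ /eqP sW]].
    by rewrite eqEsubv subvf -sW addvS // addvSr.
  - move: srt; rewrite -cats1 => /cat_sorted2[srt _].
    apply: (homo_sorted_in (P := mem r)) srt; last by apply/allP.
    move=> A B Ar Br /andP[AB neq]; rewrite /ltvs addvS //=.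
    by apply: contra neq => /eqP e; rewrite -(capK _ Ar) e capK.
rewrite pair_link; pose f' s := f [seq (<[u]> + W)%VS | W <- s].
rewrite -[RHS](mulr0 ((-1) ^+ d.-1)).
rewrite -(z0 (fun s => (last fullv s == H)%:R * f' (butlast s))) /pair mulr_sumr.
apply: eq_big_seq => p pz; have [r [K [pE sp szr]]] := flagP cz pz.
rewrite pE cobd_rcons butlast_rcons last_rcons cobd_map.
(* For empty [r] the default [fullv] of [last] is excluded too, since [H] is proper. *)
have -> : (last fullv r == H) = false.
  apply/eqP=> lr; have dH := dim_transverse nzu tH.
  case/lastP: r lr sp {szr pE} => [/= e|r L]; first by rewrite -e in dH; lia.
  rewrite last_rcons => -> sp; have := flag_last_dim nzu V0u sp.
  have /ltvs_dim : ltvs H K by rewrite (flag_below sp) // mem_rcons mem_head.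
  lia.
rewrite mul0r mulr0 addr0 [in RHS](eq_cobd (f2 := fun t => (K == H)%:R * f' t)); last first.
  by move=> t; rewrite last_rcons butlast_rcons.
have -> : cobd (fun t => (K == H)%:R * f' t) r = (K == H)%:R * cobd f' r.
  by rewrite /cobd mulr_sumr; apply: eq_bigr => i _; rewrite mulrCA.
rewrite /f'; ring.
Qed.

(** Only the fully traced simplex of each prism contributes, by [pair_prism_top], and its sign
    cancels the one in [link]. *)
Lemma pair_prismc_link f H K z : transverse u H -> chain_of V0 d z ->
    (forall t B, u \in B -> f (rcons t B) = 0) ->
  pair f (prismc K (link H z)) =
  pair (fun s => (last fullv s == H)%:R *
                 f (rcons [seq ((<[u]> + W) :&: K)%VS | W <- butlast s] K)) z.
Proof.
move=> tH cz f0; rewrite pair_prismc pair_link; apply: eq_pair => p pz.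
rewrite pair_prism_top //; last first.
  rewrite all_map; apply/allP => W _; apply: (subvP (addvSl _ _)); exact: memv_line.
have [r [L [pE _ szr]]] := flagP cz pz.
rewrite size_map -map_comp pE butlast_rcons szr mulrCA !mulrA -exprD.
by rewrite -signr_odd oddD addbb mul1r.
Qed.

End Suspension.

(** * Splitting a top cycle into suspensions *)

Theorem theorem3p9 (F : fieldType) (vT : vectType F) (V0 : {vspace vT}) :
  (exists a : F, a != 0 /\ a != 1) ->
  V0 != 0%VS ->
  St_coinvariants_vanish V0.
Proof.
move=> [a [a0 a1]] V00 z cyc; pose u := vpick V0.
have nzu : u != 0 by rewrite vpick0.
have V0u : u \in V0 := memv_pick V0.
have dt : (0 < \dim V0)%N by have /andP[] := dim_V0 nzu V0u.
have dE : (\dim V0).-1.+1 = \dim V0 by case: (\dim V0) dt.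
pose H0 := (<[u]>^C)%VS.
have t0 : transverse u H0.
  rewrite /transverse addv_complf eqxx andbT; apply/negP => uH.
  have : u \in (<[u]> :&: <[u]>^C)%VS by rewrite memv_cap memv_line.
  by rewrite capv_compl memv0 (negPf nzu).
have /is_cycleP[cz z0] := cyc.
(* The finitely many hyperplanes avoiding [u] in which a flag of [z] ends; each gives one
   suspension, with [H0] as the other pole. *)
pose Hs := undup [seq last fullv p.2 | p <- z & u \notin last fullv p.2].
have tHs H : H \in Hs -> transverse u H.
  rewrite mem_undup => /mapP[p]; rewrite mem_filter => /andP[up pz] ->.
  have [r [K [pE sp _]]] := flagP nzu V0u cz pz; move: up; rewrite pE last_rcons => uK.
  exact: (transverse_dim nzu uK (flag_last_dim nzu V0u sp)).
pose susp H := prismc H (link V0 u H z) ++ negc (prismc H0 (link V0 u H z)).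
have [gs [gsP gsE]] : exists gs : seq ('End(vT) * fchain vT),
    (forall p, p \in gs -> in_AT V0 p.1 /\ is_cycle V0 (\dim V0) p.2) /\
    forall f, pair f (flatten [seq act p.1 p.2 ++ negc p.2 | p <- gs]) =
      pair f (flatten [seq susp H | H <- Hs]).
  elim: (Hs) tHs => [|H Hs' IH] tHs'; first by exists [::].
  have [|gs [gsP gsE]] := IH; first by move=> K KH; rewrite tHs' // inE KH orbT.
  have tH : transverse u H by rewrite tHs' ?mem_head.
  have [g [y [gAT cy gyE]]] := susp_coinvariant nzu V0u a0 a1 t0 tH
    (link_over V0 u H z) (link_cycle nzu V0u tH cyc).
  exists ((g, y) :: gs); split=> [p|f].
    by rewrite inE => /predU1P[-> //|]; apply: gsP.
  by rewrite /= pair_cat gyE gsE pair_cat pair_cat pair_negc.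
have cz' : is_cycle V0 (\dim V0) (z ++ negc (flatten [seq susp H | H <- Hs])).
  apply/is_cycleP; split=> [|f].
    rewrite chain_of_cat cz chain_of_negc chain_of_flatten all_map.
    apply/allP => H HHs /=; have /is_cycleP[cl _] := link_cycle nzu V0u (tHs _ HHs) cyc.
    have pc K : transverse u K -> chain_of V0 (\dim V0) (prismc K (link V0 u H z)).
      move=> tK; rewrite -[X in chain_of _ X]dE.
      exact: (prismc_chain nzu V0u tK (link_over _ _ _ _) cl).
    by rewrite chain_of_cat chain_of_negc (pc _ t0) (pc _ (tHs _ HHs)).
  rewrite pair_cat pair_negc z0 pair_flatten big_map big1_seq ?subr0 // => H /andP[_ HHs].
  by apply: pair_cobd_prismB; have /is_cycleP[] := link_cycle nzu V0u (tHs _ HHs) cyc.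
(* The remainder is zero as a chain, so the boundary is taken empty. *)
exists gs, [::]; split=> //; split=> // s.
suff: coef (z ++ negc (flatten [seq susp H | H <- Hs])) s = 0.
  by rewrite cats0 !coef_pairE pair_cat pair_negc gsE => /eqP; rewrite subr_eq0 => /eqP.
(* Rigidity leaves the flags ending in some [K != H0] avoiding [u], which the prisms over [H0] do
   not reach. *)
apply: (top_cycle_eq0 nzu V0u t0 cz') => {}s K uK KH0.
rewrite coef_pairE pair_cat pair_negc pair_flatten big_map.
pose f (t : seq {vspace vT}) : int := (t == rcons s K)%:R; rewrite -/f.
have f0 t (B : {vspace vT}) : u \in B -> f (rcons t B) = 0.
  rewrite /f eqseq_rcons => uB; case: (B =P K) => [e|]; last by rewrite andbF.
  by rewrite -e uB in uK.
(* Sort the flags of [z] by their last vertex: [f] sees only those ending in [K], and if there are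
   any, [K] is in [Hs]. *)
have -> : pair f z = \sum_(H <- Hs) pair (fun t => (last fullv t == H)%:R * f t) z.
  rewrite exchange_big; apply: eq_big_seq => p pz /=; rewrite -mulr_sumr.
  rewrite /f; case: eqP => [pE|_]; last by rewrite mulr0 big1 ?mulr0 // => H; rewrite mulr0.
  rewrite (bigD1_seq K) ?undup_uniq //=; last first.
    rewrite mem_undup; apply/mapP; exists p; rewrite ?pE ?last_rcons //.
    by rewrite mem_filter pz pE last_rcons uK.
  rewrite pE last_rcons eqxx big1 ?addr0 // => H /negPf; rewrite eq_sym => ->.
  by rewrite mul0r.
rewrite -sumrB big1_seq // => H /andP[_ HHs]; have tH := tHs _ HHs.
rewrite pair_cat pair_negc !(pair_prismc_link nzu V0u _ tH cz f0).
have E0 : pair (fun t => (last fullv t == H)%:R *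
    f (rcons [seq ((<[u]> + W) :&: H0)%VS | W <- butlast t] H0)) z = 0.
  rewrite -(pair0 z); apply: eq_pair => p _.
  by rewrite /f eqseq_rcons [H0 == K]eq_sym (negPf KH0) andbF mulr0.
rewrite E0 subr0; apply/eqP; rewrite subr_eq0; apply/eqP/eq_pair => p pz.
have [r [L [pE sp _]]] := flagP nzu V0u cz pz; rewrite pE last_rcons butlast_rcons.
case: eqP => [LH|_]; last by rewrite !mul0r.
(* On a flag ending in [H], the trace on [H] of [<[u]> + W] is [W], so the prism restores the
   flag. *)
rewrite LH in sp *; congr (_ * f (rcons _ _)); rewrite -[LHS]map_id.
by apply/eq_in_map => W /(flag_below sp)/andP[WH _]; rewrite add_line_capK.
Qed.
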